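(* Let $A$ be a continuous dcpo with the Scott topology. For $x\in A$ let $I_x=\{y\in A\mid\{x,y\}\text{ has no upper bound in }A\}$, $J_x=\{y\in A\mid x\in\mathrm{Int}(I_y)\}$ and $J'_x=\mathrm{Int}(J_x)$, and let $\not\sim\;=\{\langle x,y\rangle\in A\times A\mid x\in J'_y\}$. Then the relation $\not\sim$ is the complement in $A\times A$ of the least closed tolerance on $A$.
   Context: Directed sets are nonempty. A dcpo is a poset with least element in which every directed subset has a least upper bound. $x\ll y$ means: for every directed $S$ with $y\sqsubseteq\sqcup S$ there is $s\in S$ with $x\sqsubseteq s$. A dcpo $A$ is continuous (with basis $K\subseteq A$) if for every $a\in A$ the set $\{k\in K\mid k\ll a\}$ is directed with supremum $a$. $U\subseteq A$ is Scott open if it is upward closed and meets every directed $S$ with $\sqcup S\in U$; $\mathrm{Int}$ is interior in the Scott topology. A tolerance is a reflexive symmetric binary relation; a closed tolerance on $A$ is a tolerance that is a closed subset of $A\times A$ in the product topology; ''least'' is with respect to inclusion. *)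

(* Defs.v *)
From HB Require Import structures.
From mathcomp Require Import all_boot all_order.
From mathcomp Require Import boolp classical_sets topology.

Set Implicit Arguments.
Unset Strict Implicit.
Unset Printing Implicit Defensive.

Local Open Scope order_scope.
Local Open Scope classical_set_scope.

Section Dcpo.
Context {d : Order.disp_t}.

Definition directed {A : porderType d} (S : set A) : Prop :=
  S !=set0 /\
  forall x y, S x -> S y -> exists2 z, S z & x <= z /\ y <= z.

(* The least element is part of the structure [bPOrderType]. *)
Definition dcpo (A : bPOrderType d) : Prop :=
  forall S : set A, directed S -> exists s, isLub S s.

Definition way_below {A : porderType d} (x y : A) : Prop :=
  forall (S : set A) (s : A), directed S -> isLub S s -> y <= s ->
    exists2 t, S t & x <= t.

Definition basis {A : porderType d} (K : set A) : Prop :=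
  forall a : A, let Ka := [set k | K k /\ way_below k a] in
    directed Ka /\ isLub Ka a.

Definition continuous_dcpo (A : bPOrderType d) : Prop :=
  dcpo A /\ exists K : set A, basis K.

Definition scott_open {A : porderType d} (U : set A) : Prop :=
  (forall x y, U x -> x <= y -> U y) /\
  (forall (S : set A) (s : A), directed S -> isLub S s -> U s ->
     S `&` U !=set0).

Lemma scott_openT {A : porderType d} : scott_open [set: A].
Proof. by split=> // S s [[x Sx] _] _ _; exists x. Qed.

Lemma scott_openI {A : porderType d} : setI_closed (@scott_open A).
Proof.
move=> U V [Uup Uin] [Vup Vin]; split=> [x y [Ux Vx] xy|S s Sdir Ss [Us Vs]].
  by split; [exact: Uup xy|exact: Vup xy].
have [x [Sx Ux]] := Uin _ _ Sdir Ss Us.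
have [y [Sy Vy]] := Vin _ _ Sdir Ss Vs.
have [z Sz [xz yz]] := Sdir.2 _ _ Sx Sy.
by exists z; split=> //; split; [exact: Uup xz|exact: Vup yz].
Qed.

Lemma scott_open_bigcup {A : porderType d} (I : Type) (f : I -> set A) :
  (forall i, scott_open (f i)) -> scott_open (\bigcup_i f i).
Proof.
move=> fo; split=> [x y [i _ fx] xy|S s Sdir Ss [i _ fs]].
  by exists i => //; exact: (fo i).1 xy.
by have [x [Sx fx]] := (fo i).2 _ _ Sdir Ss fs; exists x; split=> //; exists i.
Qed.

End Dcpo.

(* [scott A] is a copy of [A] carrying the Scott topology, so that
   [scott A * scott A] carries the product of the Scott topologies, not the
   Scott topology of the product order. *)
Definition scott {d : Order.disp_t} (A : porderType d) : Type := A.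

HB.instance Definition _ d (A : porderType d) := Choice.on (scott A).
HB.instance Definition _ d (A : porderType d) :=
  isOpenTopological.Build (scott A) (@scott_openT d A) (@scott_openI d A)
    (@scott_open_bigcup d A).

Section Tolerance.

Definition tolerance {T : Type} (R : set (T * T)) : Prop :=
  (forall x, R (x, x)) /\ (forall x y, R (x, y) -> R (y, x)).

Definition closed_tolerance {T : topologicalType} (R : set (T * T)) : Prop :=
  tolerance R /\ closed R.

Definition least_closed_tolerance {T : topologicalType} (R : set (T * T)) :
    Prop :=
  closed_tolerance R /\
  forall R' : set (T * T), closed_tolerance R' -> R `<=` R'.

End Tolerance.

Section Inconsistency.
Context {d : Order.disp_t} {A : porderType d}.

Definition I_ (x : A) : set (scott A) :=
  [set y : A | ~ has_ubound [set x; y]].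

Definition J_ (x : A) : set (scott A) := [set y : A | (I_ y)° x].

Definition J'_ (x : A) : set (scott A) := (J_ x)°.

Definition apart : set (scott A * scott A) := [set xy | J'_ xy.2 xy.1].

End Inconsistency.

(* Main.v *)
(** In any topological space, the pairs of points not separated by disjoint open
    sets form the least closed tolerance: a basic open set [U × V] missing the
    diagonal has disjoint [U] and [V].  In a continuous dcpo, [apart] is the
    relation of being separated by disjoint Scott open sets.  Indeed an upper
    bound of points of two open sets lies in both, so disjoint open sets are
    elementwise inconsistent; conversely a basis element [k << x] of the open
    set [J'_ y] gives the disjoint neighbourhoods [{z | k << z}] of [x] and
    [(I_ k)°] of [y]. *)
Require Import Defs.
From mathcomp Require Import all_boot all_order.
From mathcomp Require Import boolp classical_sets topology.

Import Order.TTheory.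

Local Open Scope order_scope.
Local Open Scope classical_set_scope.

Section Separation.
Context {T : topologicalType}.

Definition separated (x y : T) : Prop :=
  exists U V : set T, [/\ open U, open V, U x, V y & U `&` V = set0].

Lemma least_closed_tolerance_separated :
  least_closed_tolerance (~` [set xy : T * T | separated xy.1 xy.2]).
Proof.
split=> [|R [[Rxx Rsym] Rcl]].
  split; first split=> [x [U [V [_ _ Ux Vx UV0]]]|x y nxy [U [V [oU oV Uy Vx UV0]]]].
  - by have : (U `&` V) x by []; rewrite UV0.
  - by apply: nxy; exists V, U; split=> //; rewrite setIC.
  apply: open_closedC; rewrite openE => -[x y] [U [V [oU oV Ux Vy UV0]]].
  exists (U, V) => [|[u v] [Uu Vv]]; last by exists U, V.
  by split; exact: open_nbhs_nbhs.
apply: subsetCl => -[x y] nRxy.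
have : nbhs (x, y) (~` R) by apply: open_nbhs_nbhs; split=> //; exact: closed_openC.
move=> [[U V] [/= Ux Vy] UVR].
exists U°, V°; split; [exact: open_interior|exact: open_interior|by []|by []|].
(* A common point [z] would put [(z, z)] outside [R], against reflexivity. *)
rewrite -subset0 => z [/interior_subset Uz /interior_subset Vz].
exact: (UVR (z, z)).
Qed.

End Separation.

Section WayBelow.
Context {d : Order.disp_t} {A : porderType d}.
Implicit Types x y z : A.

Lemma le_way_below_trans x y z : x <= y -> way_below y z -> way_below x z.
Proof.
move=> xy yz S s Sdir Ss zs; have [t St yt] := yz _ _ Sdir Ss zs.
by exists t => //; exact: le_trans yt.
Qed.

Lemma way_below_le_trans x y z : way_below x y -> y <= z -> way_below x z.
Proof. by move=> xy yz S s Sdir Ss zs; apply: (xy S s) => //; exact: le_trans zs. Qed.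

Lemma directed1 x : directed [set x].
Proof. by split=> [|_ _ -> ->]; [exists x|exists x]. Qed.

Lemma isLub1 x : isLub [set x] x.
Proof. by split=> [_ ->|y]; last exact. Qed.

Lemma way_belowW x y : way_below x y -> x <= y.
Proof. by move=> xy; have [_ ->] := xy _ _ (directed1 y) (isLub1 y) (lexx y). Qed.

(* The basis elements way below some member of a directed set [S] form a
   directed set with the same supremum as [S]; this gives interpolation. *)
Lemma scott_open_way_below (K : set A) x :
  Defs.basis K -> scott_open [set y | way_below x y].
Proof.
move=> Kb; split=> [y z|S s Sdir [sub slub] xs]; first exact: way_below_le_trans.
pose E := [set k | K k /\ exists2 t, S t & way_below k t].
have Edir : directed E.
  split=> [|k1 k2 [_ [t1 St1 kt1]] [_ [t2 St2 kt2]]].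
    have [t St] := Sdir.1; have [[[k [Kk kt]] _] _] := Kb t.
    by exists k; split=> //; exists t.
  have [t St [t1t t2t]] := Sdir.2 _ _ St1 St2.
  have [[_ Kdir] [Kub _]] := Kb t.
  (* [k1 << t] is tested on the basis elements way below [t], directed with supremum [t]. *)
  have [k1' k1t k1k1'] : exists2 k', K k' /\ way_below k' t & k1 <= k'.
    exact: (way_below_le_trans _ _ _ kt1 t1t) (Kb t).1 (Kb t).2 (lexx t).
  have [k2' k2t k2k2'] : exists2 k', K k' /\ way_below k' t & k2 <= k'.
    exact: (way_below_le_trans _ _ _ kt2 t2t) (Kb t).1 (Kb t).2 (lexx t).
  have [k [Kk kt] [k1'k k2'k]] := Kdir _ _ k1t k2t.
  exists k; first by split=> //; exists t.
  by split; [exact: le_trans k1'k|exact: le_trans k2'k].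
have Elub : isLub E s.
  split=> [k [_ [t St /way_belowW kt]]|u Eu]; first exact: le_trans (sub _ St).
  apply: slub => t St; apply: (Kb t).2.2 => k [Kk kt].
  by apply: Eu; split=> //; exists t.
(* Testing [x << s] on [E] interpolates [x <= k << t] with [t] in [S]. *)
have [k [_ [t St kt]] xk] := xs _ _ Edir Elub (lexx s).
by exists t; split=> //; exact: le_way_below_trans kt.
Qed.

Lemma apartP (K : set A) (x y : scott A) :
  Defs.basis K -> apart (x, y) <-> separated x y.
Proof.
move=> Kb; split=> [xy|[U [V [oU oV Ux Vy UV0]]]].
  have oJ : open (J'_ (y : A)) by exact: open_interior.
  have [Kdir Klub] := Kb x.
  have [k [[Kk kx] /interior_subset Jk]] := oJ.2 _ _ Kdir Klub xy.
  exists [set z : A | way_below k z], (I_ k)°; split=> //.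
  - exact: scott_open_way_below Kb.
  - exact: open_interior.
  (* [k <= z] makes [z] itself an upper bound of [k] and [z]. *)
  rewrite -subset0 => z [/way_belowW kz /interior_subset]; apply.
  by exists z => _ [->|->].
(* The two interiors in [J'_] are handled in turn: [U] is a neighbourhood of [x] inside [J_ y]
   because, for each [u] in [U], [V] is one of [y] inside [I_ u]. *)
apply: filterS (open_nbhs_nbhs (conj oU Ux)) => u Uu.
apply: filterS (open_nbhs_nbhs (conj oV Vy)) => v Vv [w uvw].
suff : (U `&` V) w by rewrite UV0.
by split; [apply: oU.1 Uu _|apply: oV.1 Vv _]; apply: uvw; [left|right].
Qed.

End WayBelow.

Theorem theorem12p6p1 (d : Order.disp_t) (A : bPOrderType d)
    (hA : continuous_dcpo A) :
  exists R : set (scott A * scott A),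
    least_closed_tolerance R /\ @apart d A = ~` R.
Proof.
have [_ [K Kb]] := hA.
exists (~` [set xy | separated xy.1 xy.2]); split.
  exact: least_closed_tolerance_separated.
by rewrite setCK; apply/seteqP; split=> -[x y] /(apartP _ _ _ Kb).
Qed.
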